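(* Let $h,m,r,g>0$ and let $N\ge 2$ be an integer. Let $(\Omega^1_{k,k+1},\Omega^2_{k,k+1})\in\mathbb{R}^2$ and $(\Gamma^1_{k+1/2},\Gamma^2_{k+1/2},\Gamma^3_{k+1/2})\in\mathbb{R}^3$, $k=0,\dots,N-1$, be sequences that satisfy the discrete spherical pendulum equations, i.e., for every $k=1,\dots,N-1$, $$\tfrac1h r^2\big(\Omega^1_{k,k+1}-\Omega^1_{k-1,k}\big)=\tfrac12 gr\big(\Gamma^2_{k+1/2}+\Gamma^2_{k-1/2}\big),$$ $$\tfrac1h r^2\big(\Omega^2_{k,k+1}-\Omega^2_{k-1,k}\big)=-\tfrac12 gr\big(\Gamma^1_{k+1/2}+\Gamma^1_{k-1/2}\big),$$ $$\tfrac1h\big(\Gamma^1_{k+1/2}-\Gamma^1_{k-1/2}\big)=-\tfrac14\big(\Omega^2_{k,k+1}+\Omega^2_{k-1,k}\big)\big(\Gamma^3_{k+1/2}+\Gamma^3_{k-1/2}\big),$$ $$\tfrac1h\big(\Gamma^2_{k+1/2}-\Gamma^2_{k-1/2}\big)=\tfrac14\big(\Omega^1_{k,k+1}+\Omega^1_{k-1,k}\big)\big(\Gamma^3_{k+1/2}+\Gamma^3_{k-1/2}\big),$$ $$\tfrac1h\big(\Gamma^3_{k+1/2}-\Gamma^3_{k-1/2}\big)=\tfrac14\big(\Omega^2_{k,k+1}+\Omega^2_{k-1,k}\big)\big(\Gamma^1_{k+1/2}+\Gamma^1_{k-1/2}\big)-\tfrac14\big(\Omega^1_{k,k+1}+\Omega^1_{k-1,k}\big)\big(\Gamma^2_{k+1/2}+\Gamma^2_{k-1/2}\big).$$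 Then the discrete energy is conserved: the quantity $$\tfrac12 m r^2\Big[\big(\Omega^1_{k,k+1}\big)^2+\big(\Omega^2_{k,k+1}\big)^2\Big]+mgr\,\Gamma^3_{k+1/2}$$ does not depend on $k\in\{0,\dots,N-1\}$.
   Context: The equations in the claim are the discrete Hamel integrator, with time step $h$, for a spherical pendulum of mass $m$ and length $r$ in gravity $g$; here $\bm{\Gamma}=(\Gamma^1,\Gamma^2,\Gamma^3)$ is the vertical vector and $\bm{\Omega}=(\Omega^1,\Omega^2,0)$ the angular velocity, both in the body frame. Superscripts $1,2,3$ directly on $\Omega$ and $\Gamma$ are component indices, not powers (the exponent $2$ outside parentheses, and in $r^2$, is a square); the half-integer and double-integer subscripts are only labels of the sequence elements. *)

(* Defs.v *)
From mathcomp Require Import all_boot all_order all_algebra.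
From mathcomp Require Import reals.
Set Implicit Arguments.
Unset Strict Implicit.
Unset Printing Implicit Defensive.
Import Order.TTheory GRing.Theory Num.Theory.
Local Open Scope ring_scope.

(* Index [k] of a sequence stands for the label (k, k+1) in the components
   [O1], [O2] of Omega, and for the label k + 1/2 in the components [G1], [G2],
   [G3] of Gamma; hence [k.-1] stands for (k-1, k) and k - 1/2, respectively.
   The sequences have N terms; their values at indices >= N are irrelevant. *)

Definition discrete_spherical_pendulum (R : realType) (h r g : R) (N : nat)
    (O1 O2 G1 G2 G3 : nat -> R) : Prop :=
  forall k : nat, (1 <= k <= N - 1)%N ->
  [/\ 1 / h * r ^+ 2 * (O1 k - O1 k.-1) = 1 / 2 * g * r * (G2 k + G2 k.-1),
      1 / h * r ^+ 2 * (O2 k - O2 k.-1) = - (1 / 2 * g * r * (G1 k + G1 k.-1)),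
      1 / h * (G1 k - G1 k.-1) =
        - (1 / 4 * (O2 k + O2 k.-1) * (G3 k + G3 k.-1)),
      1 / h * (G2 k - G2 k.-1) = 1 / 4 * (O1 k + O1 k.-1) * (G3 k + G3 k.-1) &
      1 / h * (G3 k - G3 k.-1) =
        1 / 4 * (O2 k + O2 k.-1) * (G1 k + G1 k.-1)
        - 1 / 4 * (O1 k + O1 k.-1) * (G2 k + G2 k.-1)].

Definition discrete_energy (R : realType) (m r g : R)
    (O1 O2 G3 : nat -> R) (k : nat) : R :=
  1 / 2 * m * r ^+ 2 * (O1 k ^+ 2 + O2 k ^+ 2) + m * g * r * G3 k.

(* Main.v *)
(** Multiply the two equations for Omega by [m / 2] times the sums of
    consecutive values of [O1], [O2], and the equation for Gamma^3 by [m g r]: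
    they add up to [1 / h] times the energy increment on the left, and the
    right-hand sides cancel. *)
Require Import Defs.
From mathcomp Require Import all_boot all_order all_algebra.
From mathcomp Require Import reals.
From mathcomp Require Import ring.
Set Implicit Arguments.
Unset Strict Implicit.
Unset Printing Implicit Defensive.
Import Order.TTheory GRing.Theory Num.Theory.
Local Open Scope ring_scope.

Lemma discrete_energyS (R : realType) (h m r g : R) (N : nat)
    (O1 O2 G1 G2 G3 : nat -> R) (k : nat) :
  h != 0 -> discrete_spherical_pendulum h r g N O1 O2 G1 G2 G3 ->
  (k.+1 <= N - 1)%N ->
  discrete_energy m r g O1 O2 G3 k.+1 = discrete_energy m r g O1 O2 G3 k.
Proof.
move=> h0 pend ltkN; have [/= eO1 eO2 _ _ eG3] := pend k.+1 ltkN.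
(* As [h] is nonzero, it suffices that [h^-1] times the energy increment vanishes. *)
apply/eqP; rewrite -subr_eq0 -(mulrI_eq0 _ (mulfI (invr_neq0 h0))); apply/eqP.
(* Each sum times difference is the increment of a square in the kinetic energy. *)
transitivity (m / 2 * (O1 k.+1 + O1 k) * (1 / h * r ^+ 2 * (O1 k.+1 - O1 k))
  + m / 2 * (O2 k.+1 + O2 k) * (1 / h * r ^+ 2 * (O2 k.+1 - O2 k))
  + m * g * r * (1 / h * (G3 k.+1 - G3 k))).
  by rewrite /discrete_energy; field.
(* The products of [O1] with [G2] sums and of [O2] with [G1] sums cancel, all with coefficient
   [m * g * r / 4] up to sign. *)
by rewrite eO1 eO2 eG3; field.
Qed.

Theorem mainTheorem3 (R : realType) (h m r g : R)
    (hh : 0 < h) (hm : 0 < m) (hr : 0 < r) (hg : 0 < g)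
    (N : nat) (hN : (2 <= N)%N)
    (O1 O2 G1 G2 G3 : nat -> R)
    (Heq : discrete_spherical_pendulum h r g N O1 O2 G1 G2 G3) :
  forall k l : nat, (k <= N - 1)%N -> (l <= N - 1)%N ->
    discrete_energy m r g O1 O2 G3 k = discrete_energy m r g O1 O2 G3 l.
Proof.
(* Comparing with index 0 avoids ordering [k] and [l]. *)
have E0 k : (k <= N - 1)%N ->
    discrete_energy m r g O1 O2 G3 k = discrete_energy m r g O1 O2 G3 0.
  elim: k => // k IHk ltkN.
  by rewrite (discrete_energyS m (lt0r_neq0 hh) Heq ltkN) IHk // ltnW.
by move=> k l lekN lelN; rewrite !E0.
Qed.
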